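(* Let $G$ be a 2-walk $(a,b)$-parabolic graph. Let $R=x_1x_2\cdots x_t$ be a path or a cycle (in the latter case $x_1=x_t$) of length at least $2$ in $G$ such that $d(x_1)\geq 3$, $d(x_t)\geq 3$ and $d(x_2)=\cdots=d(x_{t-1})=2$. Then: (i) if $d(x_1)=d(x_t)$, then $l(R)\leq 3$; moreover, if $l(R)=3$, then there is no path $Q=y_1y_2y_3$ in $G$ with $d(y_1)=d(y_3)=d(x_1)$ and $d(y_2)=2$; (ii) if $d(x_1)\neq d(x_t)$, then $l(R)\leq 2$.
   Context: Graphs are finite, simple and connected; $d(v)$ denotes the degree of $v$ in $G$ and $s(v)=\sum_{u\in N_G(v)}d(u)$ where $N_G(v)$ is the neighbourhood of $v$. A graph $G$ is 2-walk $(a,b)$-parabolic if there exist uniquely a positive integer $a$ and a non-negative integer $b$ such that $a^2-8b>0$ and $s(v)=-d(v)^2+a\,d(v)-b$ for all $v\in V(G)$. The length $l(R)$ of a path or cycle $R$ is its number of edges. *)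

(* Defs.v *)
From mathcomp Require Import all_boot all_order all_algebra.
Set Implicit Arguments.
Unset Strict Implicit.
Unset Printing Implicit Defensive.
Import Order.TTheory GRing.Theory Num.Theory.

Section Graph.
Variables (T : finType) (e : rel T).

Definition simple_graph : Prop := symmetric e /\ irreflexive e.

Definition connected_graph : Prop :=
  0 < #|T| /\ forall x y : T, connect e x y.

Definition nbh (v : T) : {set T} := [set u | e v u].

Definition deg (v : T) : nat := #|nbh v|.

Definition deg2 (v : T) : nat := \sum_(u in nbh v) deg u.

Definition parabolic_relation (a b : int) : Prop :=
  [/\ (0 < a)%R, (0 <= b)%R, (0 < a ^+ 2 - 8 * b)%R
    & forall v : T,
        ((deg2 v)%:Z = - (deg v)%:Z ^+ 2 + a * (deg v)%:Z - b)%R].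

Definition two_walk_parabolic (a b : int) : Prop :=
  parabolic_relation a b /\
  forall a' b' : int, parabolic_relation a' b' -> a' = a /\ b' = b.

(* A path or cycle x_1 x_2 ... x_t is given, as in mathcomp's path.v, by its
   first vertex x = x_1 and the sequence p = x_2 ... x_t; hence x_t = last x p
   and the length (number of edges) is size p. *)
Definition graph_path (x : T) (p : seq T) : Prop :=
  path e x p /\ uniq (x :: p).

(* Here x_t = x_1, so p lists each vertex of the cycle once. *)
Definition graph_cycle (x : T) (p : seq T) : Prop :=
  [/\ path e x p, last x p = x, uniq p & 3 <= size p].

End Graph.

(* Main.v *)
(** By the parabolic relation the second degree [deg2] takes the same value at
    all vertices of degree 2, and at such a vertex it is the sum of the degrees
    of its two neighbours.  On a path or cycle of length at least 4 this gives
    d(x_1) + 2 = 2 + 2, on one of length 3 it gives d(x_1) + 2 = 2 + d(x_4), and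
    in presence of the path [y1 y2 y3] it gives d(x_1) + 2 = d(x_1) + d(x_1). *)

Require Import Defs.
From mathcomp Require Import all_boot all_order all_algebra.
Set Implicit Arguments.
Unset Strict Implicit.
Unset Printing Implicit Defensive.

(** Two distinct neighbours exhaust a neighbourhood of cardinality 2. *)
Lemma deg2_at_degree2 (T : finType) (e : rel T) (u v w : T) :
  symmetric e -> deg e v = 2 -> e u v -> e v w -> u != w ->
  deg2 e v = deg e u + deg e w.
Proof.
move=> e_sym dv euv evw neq_uw.
have nbhE : nbh e v = [set u; w].
  apply/esym/eqP; rewrite eqEcard cards2 neq_uw -[#|nbh e v|]/(deg e v) dv andbT.
  by apply/subsetP => z; rewrite !inE => /orP[]/eqP->; rewrite // e_sym.
by rewrite /deg2 nbhE big_setU1 ?inE //= big_set1.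
Qed.

Lemma parabolic_deg2_eq (T : finType) (e : rel T) (a b : int) (v w : T) :
  parabolic_relation e a b -> deg e v = deg e w -> deg2 e v = deg2 e w.
Proof. by move=> [_ _ _ E] dvw; have := E v; rewrite dvw -(E w) => -[]. Qed.

(** Ensures that [x1] and [x2] each have two distinct neighbours on the path or cycle. In a cycle,
    [x] reappears as the last entry of [x3 :: q], which by uniqueness does not contain [x2]. *)
Lemma path_or_cycle_neq (T : finType) (e : rel T) (x x1 x2 x3 : T) (q : seq T) :
  graph_path e x [:: x1, x2, x3 & q] \/ graph_cycle e x [:: x1, x2, x3 & q] ->
  x != x2 /\ x1 != x3.
Proof.
case=> [[_ /=] | [_ /= lastx]].
  by rewrite !inE !negb_or => /and4P[/and4P[_ -> _ _] /and3P[_ -> _]].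
move=> /and3P[nx1 nx2 _] _; split.
  by apply: contraNneq nx2 => <-; rewrite -{1}lastx mem_last.
by move: nx1; rewrite !inE !negb_or => /and3P[].
Qed.

Theorem lemma5 (T : finType) (e : rel T)
    (e_simple : simple_graph e) (e_conn : connected_graph e)
    (a b : int) (e_parab : two_walk_parabolic e a b)
    (x : T) (p : seq T)
    (R_path_or_cycle : graph_path e x p \/ graph_cycle e x p)
    (R_length : 2 <= size p)
    (deg_first : 3 <= deg e x) (deg_last : 3 <= deg e (last x p))
    (deg_inner : forall i : nat, 0 < i < size p ->
       deg e (nth x (x :: p) i) = 2) :
  (deg e x = deg e (last x p) ->
     size p <= 3 /\
     (size p = 3 ->
        ~ exists y1 y2 y3 : T,
            [/\ graph_path e y1 [:: y2; y3],
                deg e y1 = deg e x, deg e y3 = deg e x & deg e y2 = 2])) /\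
  (deg e x <> deg e (last x p) -> size p <= 2).
Proof.
have [e_sym _] := e_simple; have [e_par _] := e_parab.
have [le_p2 | gt_p2] := leqP (size p) 2.
  by split=> // _; split; [exact: leq_trans le_p2 _ | move=> p3; rewrite p3 in le_p2].
case: p gt_p2 R_path_or_cycle deg_last deg_inner {R_length}
  => [|x1 [|x2 [|x3 q]]] // _ R deg_last deg_inner.
have [neq02 neq13] := path_or_cycle_neq R.
have /and4P[e01 e12 e23 _] : path e x [:: x1, x2, x3 & q] by case: R => [[]|[]].
have d1 : deg e x1 = 2 by apply: (deg_inner 1).
have d2 : deg e x2 = 2 by apply: (deg_inner 2).
have s1 := deg2_at_degree2 e_sym d1 e01 e12 neq02.
have s2 := deg2_at_degree2 e_sym d2 e12 e23 neq13.
have s12 : deg e x + 2 = 2 + deg e x3.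
  by rewrite -{1}d2 -d1 -s1 -s2; apply: parabolic_deg2_eq e_par _; rewrite d1 d2.
have {}s12 : deg e x = deg e x3 by move: s12; rewrite addnC => /addnI.
(* If the length exceeds 3, then [x3] is an inner vertex, so [s12] forces [deg e x = 2]. *)
case: q R deg_last deg_inner => [|x4 q] R deg_last deg_inner; last first.
  by have d3 := deg_inner 3 isT; rewrite s12 /= in deg_first d3; rewrite d3 in deg_first.
(* Now [x3] is the last vertex, so [s12] says that the end degrees agree and (ii) is vacuous. *)
split=> // _; split=> // _ [y1 [y2 [y3 [[/and3P[f12 f23 _] y_uniq] dy1 dy3 dy2]]]].
have neq_y13 : y1 != y3.
  by move: y_uniq; rewrite /= !inE negb_or => /andP[/andP[]].
have := deg2_at_degree2 e_sym dy2 f12 f23 neq_y13.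
(* Comparing [y2] with [x1], both of degree 2, leaves [deg e x + 2 = deg e x + deg e x]. *)
rewrite (parabolic_deg2_eq e_par (etrans dy2 (esym d1))) s1 dy1 dy3 d2.
by move/addnI => dx; rewrite -dx in deg_first.
Qed.
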